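(* For $\beta\in\mathbb{C}$, $|\alpha|<1$ and $|q|<1$, \[ \sum_{n=0}^{\infty}\frac{1}{(\beta q)_n(q)_n}\left( (\alpha)_n -(\alpha)_\infty \right)=\frac{(\alpha)_\infty}{(q)_\infty}\left[ \sum_{n=1}^{\infty}\frac{n \beta^n q^{n^2}}{(\beta q)_n(q)_n}+ \frac{1}{(\beta q)_\infty}\sum_{n=1}^{\infty} \frac{(\beta q/\alpha)_n}{1-q^n}\alpha^n \right]. \]
   Context: For $x\in\mathbb{C}$ and $n\ge 0$, $(x)_n=(x;q)_n=\prod_{j=0}^{n-1}(1-xq^j)$ (with $(x)_0=1$) and $(x)_\infty=\prod_{j=0}^{\infty}(1-xq^j)$. *)

(* Defs.v *)
From Stdlib Require Import Reals.
From Coquelicot Require Import Coquelicot.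

Open Scope C_scope.

Fixpoint qpoch (x q : C) (n : nat) : C :=
  match n with
  | O => 1
  | S m => qpoch x q m * (1 - x * q ^ m)
  end.

(* [iota P] is the unique point satisfying [P] (and a junk value if there is
   none); the limit defining [qpoch_inf x q] exists whenever [Cmod q < 1]. *)
Definition qpoch_inf (x q : C) : C :=
  iota (T := C_CompleteNormedModule)
    (fun l => filterlim (qpoch x q) eventually
                (locally (T := C_CompleteNormedModule) l)).

(* Coquelicot's [Series] is real-valued; this is its complex analogue. *)
Definition ex_CSeries (u : nat -> C) : Prop :=
  ex_series (V := C_CompleteNormedModule) u.

Definition CSeries (u : nat -> C) : C :=
  iota (T := C_CompleteNormedModule)
    (fun l => is_series (V := C_CompleteNormedModule) u l).

(* [(b / a)_n * a ^ n], extended to [a = 0] by its limit as [a] tends to [0];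
   with the convention [b / 0 = 0], the bare expression would vanish at
   [a = 0] for every [n > 0].  Both cases are given uniformly
   by [qpoch_div_pow_S]. *)
Definition qpoch_div_pow (b a q : C) (n : nat) : C :=
  if Ceq_dec a 0 then (- b) ^ n * q ^ (n * (n - 1) / 2)
  else qpoch (b / a) q n * a ^ n.

Lemma qpoch_div_pow_0 (b a q : C) : qpoch_div_pow b a q 0 = 1.
Proof.
  unfold qpoch_div_pow; destruct (Ceq_dec a 0); simpl; ring.
Qed.

Lemma qpoch_div_pow_S (b a q : C) (n : nat) :
  qpoch_div_pow b a q (S n) = qpoch_div_pow b a q n * (a - b * q ^ n).
Proof.
  unfold qpoch_div_pow; destruct (Ceq_dec a 0) as [-> | Ha].
  - replace (S n * (S n - 1) / 2)%nat with (n * (n - 1) / 2 + n)%nat.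
    + rewrite Cpow_add_r; simpl; ring.
    + rewrite <- Nat.div_add by discriminate.
      f_equal; destruct n as [| n]; [reflexivity |].
      simpl Nat.sub; rewrite !Nat.sub_0_r; ring.
  - simpl; field; exact Ha.
Qed.

(* Main.v *)
(* For [|q| < 1] and [c = beta q], expand
   [(alpha)_n / (alpha)_inf = 1 / (alpha q^n)_inf = sum_k alpha^k q^(nk) / (q)_k]
   in the left-hand side and sum over [n] first: the inner sum
   [sum_n q^(nk) / ((c)_n (q)_n)] is rewritten by Heine's transformation as
   [1 / ((c)_inf (q)_inf) * sum_m (q)_(k+m-1) (-c)^m q^(m(m-1)/2) / (q)_m].
   Collecting the terms with [k + m = N], the finite q-binomial theorem gives
   [(c/alpha)_N alpha^N - (-c)^N q^(N(N-1)/2)] over [1 - q^N], where the second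
   part is the missing [k = 0] term.  Its contribution is the series with
   weights [n] on the right-hand side, by the derivative at [z = 1]
   of the finite q-binomial theorem for [(z)_N].  Below, [(-c)^n q^(n(n-1)/2)]
   appears as [qpoch_div_pow c 0 q n]; all double series are dominated by
   [M r^(i+j)] with [r < 1]. *)

Require Import Defs.
From Stdlib Require Import Reals Lra Lia.
From Coquelicot Require Import Coquelicot.

Open Scope C_scope.

(** * Limits and series of complex numbers *)

(** The predicate under [iota] in [qpoch_inf]; [is_CSeries] is the one in [CSeries], and unfolds to
    [is_Clim] of the partial sums. *)
Definition is_Clim (u : nat -> C) (l : C) : Prop :=
  filterlim u eventually (locally (T := C_CompleteNormedModule) l).

Definition is_CSeries (u : nat -> C) (l : C) : Prop :=
  is_series (V := C_CompleteNormedModule) u l.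

Lemma is_lim_seq_scal_geom (K r : R) :
  (0 <= r < 1)%R -> is_lim_seq (fun n => K * r ^ n)%R 0%R.
Proof.
  intros Hr.
  replace (Finite 0) with (Rbar_mult K 0%R) by (simpl; rewrite Rmult_0_r; reflexivity).
  apply is_lim_seq_scal_l, is_lim_seq_geom; rewrite Rabs_pos_eq; lra.
Qed.

Lemma is_Clim_unique (u : nat -> C) (l l' : C) :
  is_Clim u l -> is_Clim u l' -> l = l'.
Proof.
  exact (filterlim_locally_unique (V := C_CompleteNormedModule) u l l').
Qed.

Lemma is_Clim_squeeze (u : nat -> C) (l : C) (v : nat -> R) :
  (forall n, (Cmod (u n - l) <= v n)%R) -> is_lim_seq v 0%R -> is_Clim u l.
Proof.
  intros H Hv.
  apply (filterlim_locally_ball_norm (U := C_CompleteNormedModule)).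
  intros eps.
  apply is_lim_seq_spec in Hv; specialize (Hv eps).
  revert Hv; apply filter_imp; intros n Hn.
  apply Rle_lt_trans with (v n); [apply H |].
  rewrite Rminus_0_r in Hn; apply Rle_lt_trans with (2 := Hn), Rle_abs.
Qed.

Lemma is_Clim_ext (u v : nat -> C) (l : C) :
  (forall n, u n = v n) -> is_Clim u l -> is_Clim v l.
Proof.
  intros H; apply filterlim_ext; exact H.
Qed.

Lemma is_Clim_plus (u v : nat -> C) (l m : C) :
  is_Clim u l -> is_Clim v m -> is_Clim (fun n => u n + v n) (l + m).
Proof.
  intros Hu Hv.
  exact (filterlim_comp_2 (H := locally (T := C_CompleteNormedModule) _) _ _ _ Hu Hv
           (filterlim_plus (V := C_CompleteNormedModule) l m)).
Qed.

Lemma is_Clim_scal (c : C) (u : nat -> C) (l : C) :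
  is_Clim u l -> is_Clim (fun n => c * u n) (c * l).
Proof.
  intros Hu.
  exact (filterlim_comp _ _ _ _ _ _ _ _ Hu
           (filterlim_scal_r (V := C_CompleteNormedModule) c l)).
Qed.

Lemma is_Clim_shift (u : nat -> C) (l : C) (k : nat) :
  is_Clim u l -> is_Clim (fun n => u (k + n)%nat) l.
Proof.
  intros Hu; apply (filterlim_comp _ _ _ (fun n => (k + n)%nat) u _ eventually _); [| exact Hu].
  intros P [N HN]; exists N; intros n Hn; apply HN; lia.
Qed.

Lemma is_Clim_const (c : C) : is_Clim (fun _ => c) c.
Proof.
  apply filterlim_const.
Qed.

Lemma is_Clim_norm_le (u : nat -> C) (l : C) (M : R) :
  is_Clim u l -> (forall n, (Cmod (u n) <= M)%R) -> (Cmod l <= M)%R.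
Proof.
  intros H HM.
  assert (Hn : is_lim_seq (fun n => Cmod (u n)) (Cmod l)).
  { exact (filterlim_comp _ _ _ u Cmod _ _ _ H
             (filterlim_norm (V := C_CompleteNormedModule) l)). }
  apply (is_lim_seq_le (fun n => Cmod (u n)) (fun _ => M) (Cmod l) M HM Hn).
  apply is_lim_seq_const.
Qed.

(** [sum_n] pinned to [C], so that its equations are stated with the operations on which [ring]
    works. *)
Definition Csum (u : nat -> C) (n : nat) : C := sum_n u n.

Lemma Csum_O (u : nat -> C) : Csum u 0 = u O.
Proof.
  exact (sum_O u).
Qed.

Lemma Csum_S (u : nat -> C) (n : nat) : Csum u (S n) = Csum u n + u (S n).
Proof.
  exact (sum_Sn u n).
Qed.

Lemma Csum_ext (u v : nat -> C) (n : nat) :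
  (forall k, (k <= n)%nat -> u k = v k) -> Csum u n = Csum v n.
Proof.
  exact (sum_n_ext_loc u v n).
Qed.

Lemma Csum_norm_le (u : nat -> C) (b : R) (n : nat) :
  (forall k, (k <= n)%nat -> (Cmod (u k) <= b)%R) ->
  (Cmod (Csum u n) <= INR (S n) * b)%R.
Proof.
  induction n as [| n IH]; intros H.
  - rewrite Csum_O; simpl; rewrite Rmult_1_l; apply H; lia.
  - rewrite Csum_S, (S_INR (S n)), Rmult_plus_distr_r, Rmult_1_l.
    eapply Rle_trans; [apply Cmod_triangle |].
    apply Rplus_le_compat; [apply IH; intros k Hk |]; apply H; lia.
Qed.

Lemma Csum_scal (c : C) (u : nat -> C) (n : nat) :
  Csum (fun k => c * u k) n = c * Csum u n.
Proof.
  exact (sum_n_mult_l (K := C_AbsRing) c u n).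
Qed.

Lemma Csum_plus (u v : nat -> C) (n : nat) :
  Csum (fun k => u k + v k) n = Csum u n + Csum v n.
Proof.
  exact (sum_n_plus u v n).
Qed.

Lemma Csum_split_first (u : nat -> C) (n : nat) :
  Csum u (S n) = u O + Csum (fun k => u (S k)) n.
Proof.
  induction n as [| n IH].
  - rewrite Csum_S, !Csum_O; reflexivity.
  - rewrite Csum_S, IH, (Csum_S (fun k => u (S k))); ring.
Qed.

Lemma is_CSeries_unique (u : nat -> C) (l l' : C) :
  is_CSeries u l -> is_CSeries u l' -> l = l'.
Proof.
  apply is_Clim_unique.
Qed.

Lemma CSeries_unique (u : nat -> C) (l : C) : is_CSeries u l -> CSeries u = l.
Proof.
  intros H; apply (iota_unique (V := C_CompleteNormedModule)); [| exact H].
  intros y Hy; exact (is_CSeries_unique u y l Hy H).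
Qed.

Lemma CSeries_correct (u : nat -> C) :
  (exists l, is_CSeries u l) -> is_CSeries u (CSeries u).
Proof.
  intros [l H]; rewrite (CSeries_unique u l H); exact H.
Qed.

Lemma is_CSeries_ext (u v : nat -> C) (l : C) :
  (forall n, u n = v n) -> is_CSeries u l -> is_CSeries v l.
Proof.
  apply (is_series_ext (V := C_CompleteNormedModule)).
Qed.

Lemma is_CSeries_scal (c : C) (u : nat -> C) (l : C) :
  is_CSeries u l -> is_CSeries (fun n => c * u n) (c * l).
Proof.
  exact (is_series_scal (V := C_CompleteNormedModule) c u l).
Qed.

Lemma is_CSeries_plus (u v : nat -> C) (l m : C) :
  is_CSeries u l -> is_CSeries v m -> is_CSeries (fun n => u n + v n) (l + m).
Proof.
  exact (is_series_plus (V := C_CompleteNormedModule) u v l m).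
Qed.

Lemma is_CSeries_tail (u : nat -> C) (l : C) (n : nat) :
  is_CSeries u l -> is_CSeries (fun k => u (S n + k)%nat) (l - Csum u n).
Proof.
  intros H; apply (is_series_incr_n (V := C_CompleteNormedModule)); [lia |].
  replace (plus _ _) with l; [exact H |].
  simpl pred; change (l = l - Csum u n + Csum u n); ring.
Qed.

Lemma is_CSeries_incr (u : nat -> C) (l : C) :
  is_CSeries u l -> is_CSeries (fun k => u (S k)) (l - u O).
Proof.
  intros H; apply (is_CSeries_tail u l 0) in H; rewrite Csum_O in H; exact H.
Qed.

Lemma is_CSeries_decr (u : nat -> C) (l : C) :
  is_CSeries (fun k => u (S k)) l -> is_CSeries u (u O + l).
Proof.
  intros H; apply (is_series_decr_1 (V := C_CompleteNormedModule)).
  replace (plus _ _) with l; [exact H |].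
  change (l = u O + l - u O); ring.
Qed.

Lemma Csum_geom_bound (u : nat -> C) (M r : R) (n : nat) :
  (0 <= r < 1)%R -> (forall k, (Cmod (u k) <= M * r ^ k)%R) ->
  (Cmod (Csum u n) <= M / (1 - r))%R.
Proof.
  intros Hr H.
  assert (HM : (0 <= M)%R).
  { generalize (H O) (Cmod_ge_0 (u O)); simpl; lra. }
  (* The closed form of the majorant's partial sum makes the induction go through; dropping
     [r ^ S n] then gives the claim. *)
  assert (E : (Cmod (Csum u n) <= M * (1 - r ^ S n) / (1 - r))%R).
  { induction n as [| n IH].
    - rewrite Csum_O; replace (M * _ / _)%R with (M * r ^ 0)%R by (simpl; field; lra).
      apply H.
    - rewrite Csum_S; eapply Rle_trans; [apply Cmod_triangle |].
      eapply Rle_trans; [apply Rplus_le_compat; [exact IH | apply H] |].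
      right; simpl; field; lra. }
  eapply Rle_trans; [exact E |].
  apply Rmult_le_compat_r; [left; apply Rinv_0_lt_compat; lra |].
  generalize (pow_le r (S n) (proj1 Hr)); nra.
Qed.

Lemma ex_CSeries_geom_bound (u : nat -> C) (M r : R) :
  (0 <= r < 1)%R -> (forall k, (Cmod (u k) <= M * r ^ k)%R) ->
  exists l, is_CSeries u l.
Proof.
  intros Hr H.
  apply (ex_series_le (V := C_CompleteNormedModule) u (fun k => M * r ^ k)%R); [exact H |].
  apply (ex_series_scal (V := R_NormedModule) M (fun k => r ^ k)%R).
  apply ex_series_geom; rewrite Rabs_pos_eq; lra.
Qed.

Lemma is_CSeries_geom_bound (u : nat -> C) (l : C) (M r : R) :
  (0 <= r < 1)%R -> (forall k, (Cmod (u k) <= M * r ^ k)%R) ->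
  is_CSeries u l -> (Cmod l <= M / (1 - r))%R.
Proof.
  intros Hr H Hl; apply (is_Clim_norm_le (Csum u)); [exact Hl |].
  intros n; now apply Csum_geom_bound.
Qed.

(** * Double series *)

(** For [a i j = x i * y j] this is the n-th term of the Cauchy product. *)
Definition antidiag (a : nat -> nat -> C) (n : nat) : C :=
  Csum (fun k => a k (n - k)%nat) n.

(** This and [antidiag_S_r] shift one index when the end term is known; in the recurrences below
    that term vanishes because of a factor [1 - q ^ 0]. *)
Lemma antidiag_S_l (a : nat -> nat -> C) (n : nat) :
  antidiag a (S n) = a O (S n) + antidiag (fun i j => a (S i) j) n.
Proof.
  unfold antidiag; rewrite Csum_split_first; reflexivity.
Qed.

Lemma antidiag_S_r (a : nat -> nat -> C) (n : nat) :
  antidiag a (S n) = a (S n) O + antidiag (fun i j => a i (S j)) n.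
Proof.
  unfold antidiag; rewrite Csum_S, Nat.sub_diag, Cplus_comm; f_equal.
  apply Csum_ext; intros k Hk; f_equal; lia.
Qed.

Lemma antidiag_ext (a b : nat -> nat -> C) (n : nat) :
  (forall i j, (i + j = n)%nat -> a i j = b i j) -> antidiag a n = antidiag b n.
Proof.
  intros H; apply Csum_ext; intros k Hk; apply H; lia.
Qed.

Lemma antidiag_plus (a b : nat -> nat -> C) (n : nat) :
  antidiag (fun i j => a i j + b i j) n = antidiag a n + antidiag b n.
Proof.
  exact (Csum_plus _ _ n).
Qed.

Lemma antidiag_scal (c : C) (a : nat -> nat -> C) (n : nat) :
  antidiag (fun i j => c * a i j) n = c * antidiag a n.
Proof.
  exact (Csum_scal c _ n).
Qed.

Lemma antidiag_transpose (a : nat -> nat -> C) (n : nat) :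
  antidiag (fun i j => a j i) n = antidiag a n.
Proof.
  revert a; induction n as [| n IH]; intros a.
  - unfold antidiag; rewrite !Csum_O; reflexivity.
  - rewrite antidiag_S_l, antidiag_S_r, <- IH; reflexivity.
Qed.

(** Both sides run over the triangle [i + j <= n], by antidiagonals and by rows. *)
Lemma sum_antidiag (a : nat -> nat -> C) (n : nat) :
  Csum (antidiag a) n = Csum (fun i => Csum (a i) (n - i)) n.
Proof.
  induction n as [| n IH].
  - rewrite !Csum_O; unfold antidiag; rewrite Csum_O; reflexivity.
  - rewrite Csum_S, IH; unfold antidiag; rewrite !Csum_S, Nat.sub_diag, Csum_O.
    rewrite Cplus_assoc; f_equal.
    rewrite <- Csum_plus; apply Csum_ext; intros i Hi.
    replace (S n - i)%nat with (S (n - i)) by lia; rewrite Csum_S; reflexivity.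
Qed.

(** Divide [s^(n+1) - r^(n+1)] by [s - r]: the quotient is a sum of [n + 1] products [s^i r^(n-i)],
    each at least [r^n]. The lemma absorbs a linear factor into a slightly larger ratio. *)
Lemma linear_geom_le (r s : R) (n : nat) :
  (0 <= r < s)%R -> (INR (S n) * r ^ n <= s / (s - r) * s ^ n)%R.
Proof.
  intros Hrs.
  assert (H : (INR (S n) * r ^ n * (s - r) <= s ^ S n - r ^ S n)%R).
  { induction n as [| n IH]; [simpl; lra |].
    rewrite (S_INR (S n)).
    replace ((INR (S n) + 1) * r ^ S n * (s - r))%R
      with (r * (INR (S n) * r ^ n * (s - r)) + r ^ S n * (s - r))%R by (simpl; ring).
    assert (H1 := Rmult_le_compat_l r _ _ (proj1 Hrs) IH).
    assert (H2 : (r ^ S n <= s ^ S n)%R) by (apply pow_incr; lra).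
    assert (H3 : (r ^ S n * (s - r) <= s ^ S n * (s - r))%R)
      by (apply Rmult_le_compat_r; lra).
    change (s ^ S (S n))%R with (s * s ^ S n)%R.
    change (r ^ S (S n))%R with (r * r ^ S n)%R.
    lra. }
  assert (H0 := pow_le r (S n) (proj1 Hrs)).
  apply Rmult_le_reg_r with (s - r)%R; [lra |].
  replace (s / (s - r) * s ^ n * (s - r))%R with (s ^ S n)%R by (simpl; field; lra).
  lra.
Qed.

(* The rows [i <= n] and the triangle [i + j <= n] have sums differing by
   [O(n r^n)]. *)
Lemma antidiag_series_rows (a : nat -> nat -> C) (u : nat -> C) (M r : R) (l : C) :
  (0 <= r < 1)%R -> (forall i j, (Cmod (a i j) <= M * r ^ (i + j))%R) ->
  (forall i, is_CSeries (a i) (u i)) ->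
  is_CSeries (antidiag a) l -> is_CSeries u l.
Proof.
  intros Hr Ha Hu Hl.
  set (s := ((1 + r) / 2)%R).
  assert (Hs : (r < s < 1)%R) by (unfold s; lra).
  assert (HM : (0 <= M)%R).
  { generalize (Ha O O) (Cmod_ge_0 (a O O)); simpl; lra. }
  assert (Hdiff : is_Clim (fun n => Csum u n - Csum (antidiag a) n) 0).
  { apply (is_Clim_squeeze _ _ (fun n => M / (1 - r) * (s / (s - r)) * s ^ n)%R).
    - intros n; rewrite sum_antidiag.
      (* The difference is the sum over [i <= n] of the tails of the rows beyond column [n - i];
         each of these [n + 1] tails is at most [M r^n / (1 - r)]. *)
      eapply Rle_trans with (INR (S n) * (M / (1 - r) * r ^ n))%R.
      + replace (Csum u n - _ - 0)
          with (Csum (fun i => u i + (- (1)) * Csum (a i) (n - i)) n)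
          by (rewrite Csum_plus, Csum_scal; ring).
        apply Csum_norm_le; intros i Hi.
        replace (u i + - (1) * Csum (a i) (n - i)) with (u i - Csum (a i) (n - i)) by ring.
        replace (M / (1 - r) * r ^ n)%R with (M * r ^ n / (1 - r))%R by (field; lra).
        apply (is_CSeries_geom_bound (fun k => a i (S (n - i) + k)%nat)); [exact Hr | |].
        { intros k; eapply Rle_trans; [apply Ha |].
          replace (i + (S (n - i) + k))%nat with (S (n + k)) by lia.
          rewrite Rmult_assoc, <- pow_add; apply Rmult_le_compat_l; [exact HM |].
          generalize (pow_le r (n + k) (proj1 Hr)); simpl; nra. }
        apply is_CSeries_tail, Hu.
      + replace (INR (S n) * (M / (1 - r) * r ^ n))%R with (M / (1 - r) * (INR (S n) * r ^ n))%R by ring.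
        rewrite (Rmult_assoc (M / _)%R).
        apply Rmult_le_compat_l.
        * apply Rmult_le_pos; [exact HM | left; apply Rinv_0_lt_compat; lra].
        * apply linear_geom_le; lra.
    - apply is_lim_seq_scal_geom; lra. }
  change (is_Clim (Csum u) l); replace l with (0 + l) by ring.
  apply (is_Clim_ext (fun n => (Csum u n - Csum (antidiag a) n) + Csum (antidiag a) n)).
  - intros n; ring.
  - apply is_Clim_plus; assumption.
Qed.

(** Exchange of summation by absolute convergence. Columns are the rows of the transposed array,
    which has the same antidiagonal sums. *)
Lemma double_series (a : nat -> nat -> C) (M r : R) :
  (0 <= r < 1)%R -> (forall i j, (Cmod (a i j) <= M * r ^ (i + j))%R) ->
  exists l, is_CSeries (antidiag a) l /\
    (forall u, (forall i, is_CSeries (a i) (u i)) -> is_CSeries u l) /\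
    (forall v, (forall j, is_CSeries (fun i => a i j) (v j)) -> is_CSeries v l).
Proof.
  intros Hr Ha.
  set (s := ((1 + r) / 2)%R).
  assert (Hs : (r < s < 1)%R) by (unfold s; lra).
  assert (HM : (0 <= M)%R).
  { generalize (Ha O O) (Cmod_ge_0 (a O O)); simpl; lra. }
  destruct (ex_CSeries_geom_bound (antidiag a) (M * (s / (s - r))) s) as [l Hl]; [lra | |].
  { intros n; eapply Rle_trans.
    - apply (Csum_norm_le _ (M * r ^ n)); intros k Hk.
      eapply Rle_trans; [apply Ha |].
      replace (k + (n - k))%nat with n by lia; apply Rle_refl.
    - replace (INR (S n) * (M * r ^ n))%R with (M * (INR (S n) * r ^ n))%R by ring.
      rewrite Rmult_assoc.
      apply Rmult_le_compat_l; [exact HM |].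
      apply linear_geom_le; lra. }
  exists l; split; [exact Hl | split].
  - intros u Hu; exact (antidiag_series_rows a u M r l Hr Ha Hu Hl).
  - intros v Hv; apply (antidiag_series_rows (fun i j => a j i) v M r l Hr); [| exact Hv |].
    + intros i j; rewrite Nat.add_comm; apply Ha.
    + apply (is_CSeries_ext (antidiag a)); [| exact Hl].
      intros n; symmetry; apply antidiag_transpose.
Qed.

(** * Bounds for q-Pochhammer symbols *)

Lemma bounded_of_eventually_bounded (u : nat -> R) (b : R) (N : nat) :
  (forall n, (N <= n)%nat -> (u n <= b)%R) -> exists M : R, forall n, (u n <= M)%R.
Proof.
  revert b; induction N as [| N IH]; intros b H.
  - exists b; intros n; apply H; lia.
  - apply (IH (Rmax b (u N))); intros n Hn.
    destruct (Nat.eq_dec n N) as [-> | Hne]; [apply Rmax_r |].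
    eapply Rle_trans; [apply H; lia | apply Rmax_l].
Qed.

(** Since [1 + x <= exp x], the growth factors multiply to at most the exponential of a geometric
    series. Stated through the growth ratio, it serves [qpoch], its inverse and [qpoch_div_pow]
    alike. *)
Lemma infinite_product_bounded (u : nat -> R) (K r : R) :
  (0 <= r < 1)%R -> (0 <= K)%R -> (forall n, (0 <= u n)%R) ->
  (forall n, (u (S n) <= u n * (1 + K * r ^ n))%R) ->
  exists M : R, forall n, (u n <= M)%R.
Proof.
  intros Hr HK Hu H; exists (u O * exp (K / (1 - r)))%R; intros n.
  apply Rle_trans with (u O * exp (K * (1 - r ^ n) / (1 - r)))%R.
  - induction n as [| n IH].
    + simpl; replace (K * (1 - 1) / (1 - r))%R with 0%R by (field; lra).
      rewrite exp_0; lra.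
    + replace (K * (1 - r ^ S n) / (1 - r))%R
        with (K * (1 - r ^ n) / (1 - r) + K * r ^ n)%R by (simpl; field; lra).
      rewrite exp_plus, <- Rmult_assoc.
      eapply Rle_trans; [apply H |].
      apply Rmult_le_compat; [apply Hu | | exact IH | apply exp_ineq1_le].
      generalize (Rmult_le_pos _ _ HK (pow_le r n (proj1 Hr))); lra.
  - apply Rmult_le_compat_l; [apply Hu |].
    assert (exp_le : forall x y, (x <= y)%R -> (exp x <= exp y)%R).
    { intros x y [Hxy | ->]; [left; now apply exp_increasing | right; reflexivity]. }
    apply exp_le, Rmult_le_compat_r; [left; apply Rinv_0_lt_compat; lra |].
    generalize (pow_le r n (proj1 Hr)); nra.
Qed.

Lemma Cminus_neq_0 (x y : C) : x <> y -> y - x <> 0.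
Proof.
  intros H E; apply H; replace x with (y - (y - x)) by ring; rewrite E; ring.
Qed.

Lemma Cmod_minus_triangle (x y : C) : (Cmod (x - y) <= Cmod x + Cmod y)%R.
Proof.
  unfold Cminus; rewrite <- (Cmod_opp y); apply Cmod_triangle.
Qed.

Lemma pow_le_1 (x : R) (n : nat) : (0 <= x <= 1)%R -> (x ^ n <= 1)%R.
Proof.
  intros Hx; rewrite <- (pow1 n); now apply pow_incr.
Qed.

Lemma Cmod_pow_bounds (q : C) (n : nat) :
  (Cmod q < 1)%R -> (0 <= Cmod (q ^ n) <= 1)%R.
Proof.
  intros Hq; split; [apply Cmod_ge_0 |].
  rewrite Cmod_pow; apply pow_le_1; split; [apply Cmod_ge_0 | lra].
Qed.

Lemma mul_pow_eventually_small (x q : C) (eps : R) :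
  (Cmod q < 1)%R -> (0 < eps)%R ->
  exists N, forall n, (N <= n)%nat -> (Cmod (x * q ^ n) < eps)%R.
Proof.
  intros Hq Heps.
  assert (L := is_lim_seq_scal_geom (Cmod x) (Cmod q) (conj (Cmod_ge_0 q) Hq)).
  apply is_lim_seq_spec in L; destruct (L (mkposreal eps Heps)) as [N HN].
  exists N; intros n Hn; specialize (HN n Hn); simpl in HN.
  rewrite Rminus_0_r, <- Cmod_pow, <- Cmod_mult in HN.
  apply Rle_lt_trans with (2 := HN), Rle_abs.
Qed.

(** As [x * q ^ n] tends to 0, the denominators eventually have norm at least 1/2; the finitely many
    earlier terms only enlarge the bound. *)
Lemma inv_one_minus_bounded (x q : C) :
  (Cmod q < 1)%R -> (forall n, x * q ^ n <> 1) ->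
  exists M : R, forall n, (Cmod (/ (1 - x * q ^ n)) <= M)%R.
Proof.
  intros Hq Hx.
  destruct (mul_pow_eventually_small x q (1 / 2) Hq) as [N HN]; [lra |].
  apply (bounded_of_eventually_bounded _ 2 N); intros n Hn; specialize (HN n Hn).
  assert (H : (1 / 2 <= Cmod (1 - x * q ^ n))%R).
  { generalize (Cmod_triangle (1 - x * q ^ n) (x * q ^ n)).
    replace (1 - x * q ^ n + x * q ^ n) with (RtoC 1) by ring.
    rewrite Cmod_1; lra. }
  rewrite Cmod_inv by apply Cminus_neq_0, Hx.
  replace 2%R with (/ (1 / 2))%R by (field; lra).
  apply Rinv_le_contravar; lra.
Qed.

Lemma qpoch_neq_0 (x q : C) (n : nat) :
  (forall n, x * q ^ n <> 1) -> qpoch x q n <> 0.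
Proof.
  intros H; induction n as [| n IH]; simpl.
  - apply C1_nz.
  - apply Cmult_neq_0; [exact IH | apply Cminus_neq_0, H].
Qed.

Lemma Cpow_S_neq_1 (q : C) (n : nat) : (Cmod q < 1)%R -> q * q ^ n <> 1.
Proof.
  intros Hq E; generalize (Cmod_mult q (q ^ n)); rewrite E, Cmod_1, Cmod_pow.
  assert (Hn : (Cmod q ^ n <= 1)%R).
  { apply pow_le_1; split; [apply Cmod_ge_0 | lra]. }
  generalize (Cmod_ge_0 q) (pow_le _ n (Cmod_ge_0 q)); nra.
Qed.

Lemma qpoch_q_neq_0 (q : C) (n : nat) : (Cmod q < 1)%R -> qpoch q q n <> 0.
Proof.
  intros Hq; apply qpoch_neq_0; intros k; now apply Cpow_S_neq_1.
Qed.

Lemma qpoch_bounded (x q : C) :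
  (Cmod q < 1)%R -> exists M : R, forall n, (Cmod (qpoch x q n) <= M)%R.
Proof.
  intros Hq; apply (infinite_product_bounded _ (Cmod x) (Cmod q)).
  - split; [apply Cmod_ge_0 | exact Hq].
  - apply Cmod_ge_0.
  - intros n; apply Cmod_ge_0.
  - intros n; simpl; rewrite Cmod_mult.
    apply Rmult_le_compat_l; [apply Cmod_ge_0 |].
    eapply Rle_trans; [apply Cmod_minus_triangle |].
    rewrite Cmod_1, Cmod_mult, Cmod_pow; apply Rle_refl.
Qed.

Lemma qpoch_inv_bounded (x q : C) :
  (Cmod q < 1)%R -> (forall n, x * q ^ n <> 1) ->
  exists M : R, forall n, (Cmod (/ qpoch x q n) <= M)%R.
Proof.
  intros Hq Hx; destruct (inv_one_minus_bounded x q Hq Hx) as [K HK].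
  assert (HK0 : (0 <= K)%R) by (eapply Rle_trans; [apply Cmod_ge_0 | apply (HK O)]).
  apply (infinite_product_bounded _ (Cmod x * K) (Cmod q)).
  - split; [apply Cmod_ge_0 | exact Hq].
  - apply Rmult_le_pos; [apply Cmod_ge_0 | exact HK0].
  - intros n; apply Cmod_ge_0.
  - intros n; simpl.
    assert (H1 := qpoch_neq_0 x q n Hx).
    assert (H2 := Cminus_neq_0 _ _ (Hx n)).
    (* Writing [1 / (1 - y)] as [1 + y / (1 - y)] exhibits the growth ratio
       [1 + Cmod x * K * Cmod q ^ n]. *)
    replace (/ (qpoch x q n * (1 - x * q ^ n)))
      with (/ qpoch x q n * (1 + x * q ^ n * / (1 - x * q ^ n))) by (field; auto).
    rewrite Cmod_mult; apply Rmult_le_compat_l; [apply Cmod_ge_0 |].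
    eapply Rle_trans; [apply Cmod_triangle |].
    rewrite Cmod_1, !Cmod_mult, Cmod_pow.
    apply Rplus_le_compat_l.
    replace (Cmod x * K * Cmod q ^ n)%R with (Cmod x * Cmod q ^ n * K)%R by ring.
    apply Rmult_le_compat_l; [| apply HK].
    apply Rmult_le_pos; [apply Cmod_ge_0 | apply pow_le, Cmod_ge_0].
Qed.

(** After division by [r^n], one step multiplies the norm by at most
    [1 + (Cmod b / r) * Cmod q ^ n]. For [a = 0] every positive [r] is allowed. *)
Lemma qpoch_div_pow_bounded (b a q : C) (r : R) :
  (Cmod q < 1)%R -> (Cmod a <= r)%R -> (0 < r)%R ->
  exists M : R, forall n, (Cmod (qpoch_div_pow b a q n) <= M * r ^ n)%R.
Proof.
  intros Hq Ha Hr.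
  destruct (infinite_product_bounded
              (fun n => Cmod (qpoch_div_pow b a q n) / r ^ n)%R (Cmod b / r) (Cmod q))
    as [M HM].
  - split; [apply Cmod_ge_0 | exact Hq].
  - apply Rmult_le_pos; [apply Cmod_ge_0 | left; apply Rinv_0_lt_compat, Hr].
  - intros n; apply Rmult_le_pos; [apply Cmod_ge_0 |].
    left; apply Rinv_0_lt_compat, pow_lt, Hr.
  - intros n; rewrite qpoch_div_pow_S, Cmod_mult; simpl.
    assert (Hn := pow_lt r n Hr).
    replace (Cmod (qpoch_div_pow b a q n) / r ^ n * (1 + Cmod b / r * Cmod q ^ n))%R
      with (Cmod (qpoch_div_pow b a q n) * (r + Cmod b * Cmod q ^ n) / (r * r ^ n))%R
      by (field; lra).
    apply Rmult_le_compat_r; [left; apply Rinv_0_lt_compat; nra |].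
    apply Rmult_le_compat_l; [apply Cmod_ge_0 |].
    eapply Rle_trans; [apply Cmod_minus_triangle |].
    rewrite Cmod_mult, Cmod_pow; lra.
  - exists M; intros n; specialize (HM n); simpl in HM.
    assert (Hn := pow_lt r n Hr).
    apply Rmult_le_reg_r with (/ r ^ n)%R; [apply Rinv_0_lt_compat, Hn |].
    rewrite Rmult_assoc, Rinv_r, Rmult_1_r by lra; exact HM.
Qed.

Lemma qpoch_div_pow_div_bounded (b a q : C) (r : R) :
  (Cmod q < 1)%R -> (Cmod a <= r)%R -> (0 < r)%R ->
  exists M : R, forall n,
    (Cmod (qpoch_div_pow b a q n / qpoch q q n) <= M * r ^ n)%R.
Proof.
  intros Hq Ha Hr.
  destruct (qpoch_div_pow_bounded b a q r Hq Ha Hr) as [M HM].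
  destruct (qpoch_inv_bounded q q Hq) as [K HK].
  { intros n; now apply Cpow_S_neq_1. }
  exists (M * K)%R; intros n; unfold Cdiv; rewrite Cmod_mult.
  replace (M * K * r ^ n)%R with (M * r ^ n * K)%R by ring.
  apply Rmult_le_compat; [apply Cmod_ge_0 | apply Cmod_ge_0 | apply HM | apply HK].
Qed.

(** * Infinite q-Pochhammer symbols *)

Lemma is_Clim_qpoch_inf (x q : C) :
  (Cmod q < 1)%R -> is_Clim (qpoch x q) (qpoch_inf x q).
Proof.
  intros Hq.
  (* The increments of [qpoch x q]: the product becomes a telescoping series with a geometric
     majorant. *)
  set (u := fun n => match n with O => RtoC 1 | S m => - x * q ^ m * qpoch x q m end).
  assert (Hu : forall n, Csum u n = qpoch x q n).
  { induction n as [| n IH]; [rewrite Csum_O; reflexivity |].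
    rewrite Csum_S, IH; unfold u; simpl; ring. }
  destruct (qpoch_bounded x q Hq) as [M HM].
  destruct (ex_CSeries_geom_bound (fun n => u (S n)) (Cmod x * M) (Cmod q)) as [l Hl].
  { split; [apply Cmod_ge_0 | exact Hq]. }
  { intros n; unfold u; rewrite !Cmod_mult, Cmod_opp, Cmod_pow.
    replace (Cmod x * M * Cmod q ^ n)%R with (Cmod x * Cmod q ^ n * M)%R by ring.
    apply Rmult_le_compat_l; [| apply HM].
    apply Rmult_le_pos; [apply Cmod_ge_0 | apply pow_le, Cmod_ge_0]. }
  apply is_CSeries_decr in Hl.
  assert (L : is_Clim (qpoch x q) (u O + l)) by exact (is_Clim_ext _ _ _ Hu Hl).
  assert (E : qpoch_inf x q = u O + l)
    by exact (iota_filterlim_locally (V := C_CompleteNormedModule) _ _ L).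
  rewrite E; exact L.
Qed.

Lemma qpoch_add (x q : C) (n m : nat) :
  qpoch x q (n + m) = qpoch x q n * qpoch (x * q ^ n) q m.
Proof.
  induction m as [| m IH].
  - rewrite Nat.add_0_r; simpl; ring.
  - rewrite Nat.add_succ_r; simpl; rewrite IH, Cpow_add_r; ring.
Qed.

Lemma qpoch_inf_split (x q : C) (n : nat) :
  (Cmod q < 1)%R -> qpoch_inf x q = qpoch x q n * qpoch_inf (x * q ^ n) q.
Proof.
  intros Hq; apply (is_Clim_unique (fun m => qpoch x q (n + m))).
  - apply is_Clim_shift; now apply is_Clim_qpoch_inf.
  - apply (is_Clim_ext (fun m => qpoch x q n * qpoch (x * q ^ n) q m)).
    + intros m; symmetry; apply qpoch_add.
    + apply is_Clim_scal; now apply is_Clim_qpoch_inf.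
Qed.

Lemma qpoch_inf_0 (q : C) : (Cmod q < 1)%R -> qpoch_inf 0 q = 1.
Proof.
  intros Hq; apply (is_Clim_unique (qpoch 0 q)); [now apply is_Clim_qpoch_inf |].
  apply (is_Clim_ext (fun _ => 1)); [| apply is_Clim_const].
  induction n as [| n IH]; [reflexivity | simpl; rewrite <- IH; ring].
Qed.

(** Each factor [a - b * q ^ n] is homogeneous of degree one in [(a, b)]. *)
Lemma qpoch_div_pow_scale (c b a q : C) (n : nat) :
  qpoch_div_pow (c * b) (c * a) q n = c ^ n * qpoch_div_pow b a q n.
Proof.
  induction n as [| n IH].
  - rewrite !qpoch_div_pow_0; simpl; ring.
  - rewrite !qpoch_div_pow_S, IH; simpl; ring.
Qed.

(** * The q-binomial theorem and Euler's identities *)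

(** With [p n] the n-th term of the first series, [s - s'] is the sum of [(1 - q^n) p n]. Its term
    at 0 vanishes and the recurrence turns the term at [n + 1] into [(a - b q^n) p n], so
    [s - s' = a s - b s']. *)
Lemma q_binomial_step (a b q s s' : C) :
  (Cmod q < 1)%R ->
  is_CSeries (fun n => qpoch_div_pow b a q n / qpoch q q n) s ->
  is_CSeries (fun n => qpoch_div_pow (q * b) (q * a) q n / qpoch q q n) s' ->
  (1 - a) * s = (1 - b) * s'.
Proof.
  intros Hq Hs Hs'.
  set (p := fun n => qpoch_div_pow b a q n / qpoch q q n) in *.
  assert (Hs2 : is_CSeries (fun n => q ^ n * p n) s').
  { apply is_CSeries_ext with (2 := Hs'); intros n; unfold p.
    rewrite qpoch_div_pow_scale; unfold Cdiv; ring. }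
  assert (H1 : is_CSeries (fun n => p n + - (1) * (q ^ n * p n)) (s + - (1) * s')).
  { apply is_CSeries_plus, is_CSeries_scal; assumption. }
  assert (H2 : is_CSeries (fun n => a * p n + - b * (q ^ n * p n)) (a * s + - b * s')).
  { apply is_CSeries_plus; now apply is_CSeries_scal. }
  apply is_CSeries_incr in H1; simpl in H1.
  assert (E : s + - (1) * s' - (p O + - (1) * (1 * p O)) = a * s + - b * s').
  { apply (is_CSeries_unique _ _ _ H1); apply is_CSeries_ext with (2 := H2); intros n; unfold p.
    rewrite qpoch_div_pow_S; simpl; field; split.
    - apply Cminus_neq_0; now apply Cpow_S_neq_1.
    - now apply qpoch_q_neq_0. }
  replace ((1 - a) * s) with (s + - (1) * s' - (p O + - (1) * (1 * p O)) + s' - a * s) by ring.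
  rewrite E; ring.
Qed.

(* Iterating [q_binomial_step] gives [(a)_n s = (b)_n s_n], where [s_n -> 1]. *)
Lemma q_binomial (a b q : C) :
  (Cmod q < 1)%R -> (Cmod a < 1)%R ->
  exists s, is_CSeries (fun n => qpoch_div_pow b a q n / qpoch q q n) s /\
    qpoch_inf a q * s = qpoch_inf b q.
Proof.
  intros Hq Ha.
  set (p := fun n => qpoch_div_pow b a q n / qpoch q q n).
  set (r := ((1 + Cmod a) / 2)%R).
  assert (Hr : (Cmod a <= r /\ 0 < r < 1)%R) by (generalize (Cmod_ge_0 a); unfold r; lra).
  destruct (qpoch_div_pow_div_bounded b a q r Hq) as [M HM]; [lra | lra |].
  assert (HM0 : (0 <= M)%R).
  { generalize (HM O) (Cmod_ge_0 (qpoch_div_pow b a q 0 / qpoch q q 0)); simpl; lra. }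
  fold p in HM.
  set (pn := fun n k => qpoch_div_pow (q ^ n * b) (q ^ n * a) q k / qpoch q q k).
  assert (Epn : forall n k, pn n k = (q ^ n) ^ k * p k).
  { intros n k; unfold pn, p; rewrite qpoch_div_pow_scale; unfold Cdiv; ring. }
  assert (Hqn : forall n, (Cmod q ^ n <= 1)%R).
  { intros n; apply pow_le_1; split; [apply Cmod_ge_0 | lra]. }
  assert (Hpos : forall n, (0 <= Cmod q ^ n)%R) by (intros n; apply pow_le, Cmod_ge_0).
  assert (Hpow : forall n k, ((Cmod q ^ n) ^ k <= 1)%R).
  { intros n k; apply pow_le_1; auto. }
  assert (Hs : forall n, is_CSeries (pn n) (CSeries (pn n))).
  { intros n; apply CSeries_correct, (ex_CSeries_geom_bound _ M r); [lra |].
    intros k; rewrite Epn, Cmod_mult, !Cmod_pow, <- (Rmult_1_l (M * r ^ k)).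
    apply Rmult_le_compat; [apply pow_le; auto | apply Cmod_ge_0 | auto | apply HM]. }
  assert (Hrec : forall n, qpoch a q n * CSeries (pn O) = qpoch b q n * CSeries (pn n)).
  { induction n as [| n IH]; [reflexivity |].
    simpl.
    assert (E : (1 - q ^ n * a) * CSeries (pn n) = (1 - q ^ n * b) * CSeries (pn (S n))).
    { apply (q_binomial_step _ _ q); [exact Hq | apply Hs |].
      apply is_CSeries_ext with (2 := Hs (S n)); intros k; unfold pn.
      simpl; rewrite !Cmult_assoc; reflexivity. }
    transitivity ((1 - q ^ n * a) * (qpoch a q n * CSeries (pn O))); [ring |].
    rewrite IH.
    transitivity (qpoch b q n * ((1 - q ^ n * a) * CSeries (pn n))); [ring |].
    rewrite E; ring. }
  (* The constant term is 1, and every later term carries at least one factor [q ^ n]. *)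
  assert (Hlim : forall n, (Cmod (CSeries (pn n) - 1) <= M / (1 - r) * Cmod q ^ n)%R).
  { intros n.
    replace (RtoC 1) with (pn n O)
      by (unfold pn; rewrite qpoch_div_pow_0; simpl; field; apply C1_nz).
    replace (M / (1 - r) * Cmod q ^ n)%R with (M * Cmod q ^ n / (1 - r))%R by (field; lra).
    apply (is_CSeries_geom_bound (fun k => pn n (S k)) _ _ r); [lra | |].
    - intros k; rewrite Epn, Cmod_mult, !Cmod_pow; simpl.
      specialize (HM (S k)); simpl in HM.
      assert (Hrk := pow_le r k (Rlt_le _ _ (proj1 (proj2 Hr)))).
      replace (M * Cmod q ^ n * r ^ k)%R with (Cmod q ^ n * 1 * (M * r ^ k))%R by ring.
      apply Rmult_le_compat; [| apply Cmod_ge_0 | |].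
      + apply Rmult_le_pos; [auto | apply pow_le; auto].
      + apply Rmult_le_compat_l; auto.
      + eapply Rle_trans; [exact HM |].
        apply Rmult_le_compat_l; [exact HM0 | nra].
    - apply is_CSeries_incr, Hs. }
  exists (CSeries (pn O)); split.
  { apply is_CSeries_ext with (2 := Hs O); intros k; rewrite Epn; simpl.
    rewrite Cpow_1_l; ring. }
  destruct (qpoch_bounded b q Hq) as [K HK].
  assert (HK0 : (0 <= K)%R) by (eapply Rle_trans; [apply Cmod_ge_0 | apply (HK O)]).
  apply (is_Clim_unique (fun n => CSeries (pn O) * qpoch a q n)).
  { rewrite Cmult_comm; apply is_Clim_scal; now apply is_Clim_qpoch_inf. }
  replace (qpoch_inf b q) with (0 + qpoch_inf b q) by ring.
  apply (is_Clim_ext (fun n => qpoch b q n * (CSeries (pn n) - 1) + qpoch b q n)).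
  { intros n; rewrite (Cmult_comm (CSeries _)), Hrec; ring. }
  apply is_Clim_plus; [| now apply is_Clim_qpoch_inf].
  apply (is_Clim_squeeze _ _ (fun n => K * (M / (1 - r)) * Cmod q ^ n)%R).
  - intros n; replace (qpoch b q n * (CSeries (pn n) - 1) - 0)
      with (qpoch b q n * (CSeries (pn n) - 1)) by ring.
    rewrite Cmod_mult, Rmult_assoc.
    apply Rmult_le_compat; [apply Cmod_ge_0 | apply Cmod_ge_0 | apply HK | apply Hlim].
  - apply is_lim_seq_scal_geom; split; [apply Cmod_ge_0 | exact Hq].
Qed.

Lemma qpoch_div_pow_0_l (a q : C) (n : nat) : qpoch_div_pow 0 a q n = a ^ n.
Proof.
  induction n as [| n IH]; [apply qpoch_div_pow_0 |].
  rewrite qpoch_div_pow_S, IH; simpl; ring.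
Qed.

(** The case [b = 0] of [q_binomial]. It is kept as a product because it is what shows
    [qpoch_inf x q] to be nonzero on the disk. *)
Lemma qpoch_inf_mul_euler (x q : C) :
  (Cmod q < 1)%R -> (Cmod x < 1)%R ->
  exists s, is_CSeries (fun n => x ^ n / qpoch q q n) s /\ qpoch_inf x q * s = 1.
Proof.
  intros Hq Hx; destruct (q_binomial x 0 q Hq Hx) as [s [Hs E]].
  exists s; split; [| rewrite E; now apply qpoch_inf_0].
  apply is_CSeries_ext with (2 := Hs); intros n; now rewrite qpoch_div_pow_0_l.
Qed.

Lemma qpoch_inf_neq_0_disk (x q : C) :
  (Cmod q < 1)%R -> (Cmod x < 1)%R -> qpoch_inf x q <> 0.
Proof.
  intros Hq Hx E; destruct (qpoch_inf_mul_euler x q Hq Hx) as [s [_ H]].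
  apply C1_nz; rewrite <- H, E; ring.
Qed.

Lemma euler_inv (x q : C) :
  (Cmod q < 1)%R -> (Cmod x < 1)%R ->
  is_CSeries (fun n => x ^ n / qpoch q q n) (/ qpoch_inf x q).
Proof.
  intros Hq Hx; destruct (qpoch_inf_mul_euler x q Hq Hx) as [s [Hs E]].
  assert (Hn := qpoch_inf_neq_0_disk x q Hq Hx).
  replace (/ qpoch_inf x q) with s; [exact Hs |].
  transitivity (qpoch_inf x q * s / qpoch_inf x q); [field; exact Hn |].
  rewrite E; field; exact Hn.
Qed.

(** The case [a = 0] of [q_binomial], where the denominator [qpoch_inf 0 q] is 1. *)
Lemma euler (x q : C) :
  (Cmod q < 1)%R ->
  is_CSeries (fun n => qpoch_div_pow x 0 q n / qpoch q q n) (qpoch_inf x q).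
Proof.
  intros Hq; destruct (q_binomial 0 x q Hq) as [s [Hs E]].
  - rewrite Cmod_0; lra.
  - rewrite qpoch_inf_0, Cmult_1_l in E by exact Hq; rewrite <- E; exact Hs.
Qed.

(** Splitting off finitely many nonzero factors moves the base point into the unit disk. *)
Lemma qpoch_inf_neq_0 (x q : C) :
  (Cmod q < 1)%R -> (forall n, x * q ^ n <> 1) -> qpoch_inf x q <> 0.
Proof.
  intros Hq Hx.
  destruct (mul_pow_eventually_small x q 1 Hq Rlt_0_1) as [N HN].
  specialize (HN N (le_n N)).
  rewrite (qpoch_inf_split x q N Hq).
  apply Cmult_neq_0; [now apply qpoch_neq_0 | now apply qpoch_inf_neq_0_disk].
Qed.

Lemma Cmod_mul_pow_lt_1 (x q : C) (n : nat) :
  (Cmod q < 1)%R -> (Cmod x < 1)%R -> (Cmod (x * q ^ n) < 1)%R.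
Proof.
  intros Hq Hx; rewrite Cmod_mult, Cmod_pow.
  assert (Hn : (Cmod q ^ n <= 1)%R).
  { apply pow_le_1; split; [apply Cmod_ge_0 | lra]. }
  generalize (Cmod_ge_0 x) (pow_le _ n (Cmod_ge_0 q)); nra.
Qed.

(** * Finite identities *)

(* [1 - q^(i+j) = (1 - q^i) + q^i (1 - q^j)], and each factor cancels against
   the last factor of one of the two Pochhammer symbols in the denominators. *)
Lemma finite_q_binomial (a b q : C) (n : nat) :
  (Cmod q < 1)%R ->
  qpoch_div_pow b a q n / qpoch q q n =
  antidiag (fun i j => a ^ i / qpoch q q i * (qpoch_div_pow b 0 q j / qpoch q q j)) n.
Proof.
  intros Hq.
  set (x := fun i => a ^ i / qpoch q q i).
  set (y := fun j => qpoch_div_pow b 0 q j / qpoch q q j).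
  assert (H1 : forall n, 1 - q * q ^ n <> 0)
    by (intros k; apply Cminus_neq_0; now apply Cpow_S_neq_1).
  assert (H2 : forall n, qpoch q q n <> 0) by (intros k; now apply qpoch_q_neq_0).
  assert (Hx : forall i, (1 - q * q ^ i) * x (S i) = a * x i).
  { intros i; unfold x; simpl; field; auto. }
  assert (Hy : forall j, (1 - q * q ^ j) * y (S j) = - b * q ^ j * y j).
  { intros j; unfold y; rewrite qpoch_div_pow_S; simpl; field; auto. }
  change (qpoch_div_pow b a q n / qpoch q q n = antidiag (fun i j => x i * y j) n).
  induction n as [| n IH].
  - unfold antidiag; rewrite Csum_O; unfold x, y; rewrite !qpoch_div_pow_0; simpl.
    field; apply C1_nz.
  (* The convolution obeys the same first-order recurrence as the left-hand side. *)
  - assert (E : (1 - q * q ^ n) * antidiag (fun i j => x i * y j) (S n) =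
                (a - b * q ^ n) * antidiag (fun i j => x i * y j) n).
    { rewrite <- antidiag_scal.
      rewrite (antidiag_ext _ (fun i j => (1 - q ^ i) * x i * y j + q ^ i * x i * ((1 - q ^ j) * y j))).
      2:{ intros i j Hij; change (q * q ^ n) with (q ^ S n); rewrite <- Hij, Cpow_add_r; ring. }
      rewrite antidiag_plus, antidiag_S_l, antidiag_S_r.
      rewrite <- antidiag_scal.
      simpl Cpow at 1 4; replace (1 - 1) with (RtoC 0) by ring.
      rewrite !Cmult_0_l, !Cmult_0_r, !Cplus_0_l, <- antidiag_plus.
      apply antidiag_ext; intros i j Hij.
      change (q ^ S i) with (q * q ^ i); change (q ^ S j) with (q * q ^ j).
      rewrite Hx, Hy, <- Hij, Cpow_add_r; ring. }
    rewrite qpoch_div_pow_S; simpl qpoch.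
    transitivity ((a - b * q ^ n) * (qpoch_div_pow b a q n / qpoch q q n) / (1 - q * q ^ n)).
    { field; auto. }
    rewrite IH, <- E; field; auto.
Qed.

(* The derivative at [z = 1] of [finite_q_binomial] for [(z)_n]. *)
Lemma weighted_finite_q_binomial (q : C) (n : nat) :
  (Cmod q < 1)%R ->
  antidiag (fun i j => RtoC (INR i) * (qpoch_div_pow 1 0 q i / qpoch q q i) *
                       (1 / qpoch q q j)) (S n) = - (1) / (1 - q ^ S n).
Proof.
  intros Hq.
  set (y := fun i => qpoch_div_pow 1 0 q i / qpoch q q i).
  set (x := fun j => 1 / qpoch q q j).
  assert (H1 : forall n, 1 - q * q ^ n <> 0)
    by (intros k; apply Cminus_neq_0; now apply Cpow_S_neq_1).
  assert (H2 : forall n, qpoch q q n <> 0) by (intros k; now apply qpoch_q_neq_0).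
  assert (Hx : forall j, (1 - q * q ^ j) * x (S j) = x j).
  { intros j; unfold x; simpl; field; auto. }
  assert (Hy : forall i, (1 - q * q ^ i) * y (S i) = - q ^ i * y i).
  { intros i; unfold y; rewrite qpoch_div_pow_S; simpl; field; auto. }
  set (W := antidiag (fun i j => RtoC (INR i) * y i * x j)).
  set (V := antidiag (fun i j => y i * x j)).
  (* [V] is the unweighted sum, that is [(1)_n / (q)_n], which vanishes for [n > 0]. *)
  assert (HV : forall n, V n = qpoch_div_pow 1 1 q n / qpoch q q n).
  { intros k; rewrite finite_q_binomial by exact Hq; unfold V.
    rewrite <- antidiag_transpose; apply antidiag_ext; intros i j _.
    unfold x, y; rewrite Cpow_1_l; ring. }
  assert (HV1 : forall n, V (S n) = 0).
  { intros k; rewrite HV.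
    assert (E : qpoch_div_pow 1 1 q (S k) = 0).
    { induction k as [| k IH]; rewrite qpoch_div_pow_S; [simpl; ring | rewrite IH; ring]. }
    rewrite E; unfold Cdiv; ring. }
  (* Split [1 - q^(i+j)] as [(1 - q^j) + q^j (1 - q^i)]. Shifting [i] turns the weight [i] into
     [i + 1], and the extra 1 produces [V]. *)
  assert (HW : forall n, (1 - q * q ^ n) * W (S n) = (1 - q ^ n) * W n - q ^ n * V n).
  { intros k; unfold W; rewrite <- antidiag_scal.
    rewrite (antidiag_ext _ (fun i j => RtoC (INR i) * y i * ((1 - q ^ j) * x j) +
                                        RtoC (INR i) * q ^ j * ((1 - q ^ i) * y i) * x j)).
    2:{ intros i j Hij; change (q * q ^ k) with (q ^ S k); rewrite <- Hij, Cpow_add_r; ring. }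
    rewrite antidiag_plus, antidiag_S_r, antidiag_S_l.
    replace (RtoC (INR (S k)) * y (S k) * ((1 - q ^ 0) * x O)) with (RtoC 0) by (simpl; ring).
    replace (RtoC (INR 0) * q ^ S k * ((1 - q ^ 0) * y O) * x (S k)) with (RtoC 0)
      by (simpl; ring).
    rewrite !Cplus_0_l, <- antidiag_plus.
    unfold V.
    replace ((1 - q ^ k) * antidiag (fun i j => RtoC (INR i) * y i * x j) k -
             q ^ k * antidiag (fun i j => y i * x j) k)
      with ((1 - q ^ k) * antidiag (fun i j => RtoC (INR i) * y i * x j) k +
            - q ^ k * antidiag (fun i j => y i * x j) k) by ring.
    rewrite <- !antidiag_scal, <- antidiag_plus.
    apply antidiag_ext; intros i j Hij.
    change (q ^ S i) with (q * q ^ i); change (q ^ S j) with (q * q ^ j).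
    rewrite Hx, Hy, S_INR, RtoC_plus, <- Hij, Cpow_add_r; ring. }
  (* At [n = 0] only [- V 0] remains; afterwards [V] vanishes and the quantity stays constant. *)
  assert (E : (1 - q * q ^ n) * W (S n) = - (1)).
  { induction n as [| n IH]; rewrite HW.
    - rewrite HV, qpoch_div_pow_0; simpl; field; apply C1_nz.
    - rewrite HV1; simpl; rewrite IH; ring. }
  change (W (S n) = - (1) / (1 - q * q ^ n)); rewrite <- E; field; apply H1.
Qed.

(** * The three series *)

(** The triangular exponents at [n] and [m] add up to the one at [n + m] less [n m], whence the
    factor [(q ^ n) ^ m]. *)
Lemma qpoch_div_pow_shift (b q : C) (n m : nat) :
  qpoch_div_pow b 0 q (n + m) =
  qpoch_div_pow b 0 q n * ((q ^ n) ^ m * qpoch_div_pow b 0 q m).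
Proof.
  induction m as [| m IH].
  - rewrite Nat.add_0_r, qpoch_div_pow_0; simpl; ring.
  - rewrite Nat.add_succ_r, !qpoch_div_pow_S, IH, Cpow_add_r; simpl; ring.
Qed.

Lemma euler_shift (x q : C) (n : nat) :
  (Cmod q < 1)%R ->
  is_CSeries (fun m => (q ^ n) ^ m * (qpoch_div_pow x 0 q m / qpoch q q m))
    (qpoch_inf (x * q ^ n) q).
Proof.
  intros Hq; apply is_CSeries_ext with (2 := euler (x * q ^ n) q Hq); intros m.
  assert (E := qpoch_div_pow_scale (q ^ n) x 0 q m).
  rewrite Cmult_0_r in E; rewrite Cmult_comm, E; unfold Cdiv; ring.
Qed.

(* Heine's transformation of [2phi1(0, 0; c; q, z)]: expand
   [(c)_inf / (c)_n = (c q^n)_inf] by Euler's identity and sum over [n] first. *)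
Lemma heine (c q z : C) :
  (Cmod q < 1)%R -> (Cmod z < 1)%R -> (forall n, c * q ^ n <> 1) ->
  exists s, is_CSeries (fun n => z ^ n / (qpoch c q n * qpoch q q n)) s /\
    is_CSeries (fun m => qpoch_div_pow c 0 q m / qpoch q q m / qpoch_inf (z * q ^ m) q)
      (qpoch_inf c q * s).
Proof.
  intros Hq Hz Hc.
  set (r := ((1 + Cmod z) / 2)%R).
  assert (Hr : (Cmod z <= r /\ 0 < r < 1)%R) by (generalize (Cmod_ge_0 z); unfold r; lra).
  destruct (qpoch_div_pow_div_bounded 0 z q r Hq) as [M HM]; [lra | lra |].
  destruct (qpoch_div_pow_div_bounded c 0 q r Hq) as [K HK]; [rewrite Cmod_0; lra | lra |].
  destruct (double_series
    (fun n m => z ^ n / qpoch q q n *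
                ((q ^ n) ^ m * (qpoch_div_pow c 0 q m / qpoch q q m))) (M * K) r)
    as [l [_ [Hrow Hcol]]]; [lra | |].
  { intros n m; rewrite !Cmod_mult, Cmod_pow, pow_add.
    specialize (HM n); rewrite qpoch_div_pow_0_l in HM.
    replace (M * K * (r ^ n * r ^ m))%R with (M * r ^ n * (1 * (K * r ^ m)))%R by ring.
    assert (Hqn := Cmod_pow_bounds q n Hq).
    apply Rmult_le_compat; [apply Cmod_ge_0 | | exact HM |].
    - apply Rmult_le_pos; [apply pow_le; lra | apply Cmod_ge_0].
    - apply Rmult_le_compat; [apply pow_le; lra | apply Cmod_ge_0 | now apply pow_le_1 | apply HK]. }
  assert (Hinf := qpoch_inf_neq_0 c q Hq Hc).
  (* Row [n] sums to [z^n / (q)_n] times [(c q^n)_inf], which is [(c)_inf] times the wanted term;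
     column [m] is the inverse Euler series at [z q^m]. *)
  exists (/ qpoch_inf c q * l); split.
  - apply is_CSeries_ext
      with (fun n => / qpoch_inf c q * (z ^ n / qpoch q q n * qpoch_inf (c * q ^ n) q)).
    + intros n; assert (Hn := qpoch_neq_0 c q n Hc); assert (Hn' := qpoch_q_neq_0 q n Hq).
      rewrite (qpoch_inf_split c q n Hq) in Hinf |- *.
      field; repeat split; auto; intros E; apply Hinf; rewrite E; ring.
    + apply is_CSeries_scal, Hrow; intros n; apply is_CSeries_scal; now apply euler_shift.
  - replace (qpoch_inf c q * (/ qpoch_inf c q * l)) with l by (field; exact Hinf).
    apply Hcol; intros m; unfold Cdiv at 1.
    apply is_CSeries_ext with (fun n =>
      qpoch_div_pow c 0 q m / qpoch q q m * ((z * q ^ m) ^ n / qpoch q q n)).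
    + intros n; rewrite Cpow_mult_l, <- !Cpow_mult_r, (Nat.mul_comm m n); unfold Cdiv; ring.
    + apply is_CSeries_scal, euler_inv; [exact Hq | now apply Cmod_mul_pow_lt_1].
Qed.

(** At [z = q^(k+1)] the denominator in [heine] becomes [(q)_inf / (q)_(k+m)]. The exponent starts
    at 1, since [z = 1] lies outside the disk. *)
Lemma heine_pow (c q : C) (k : nat) :
  (Cmod q < 1)%R -> (forall n, c * q ^ n <> 1) ->
  exists s, is_CSeries (fun n => (q ^ n) ^ S k / (qpoch c q n * qpoch q q n)) s /\
    is_CSeries (fun m => qpoch_div_pow c 0 q m / qpoch q q m * qpoch q q (k + m))
      (qpoch_inf q q * (qpoch_inf c q * s)).
Proof.
  intros Hq Hc.
  destruct (heine c q (q ^ S k) Hq) as [s [Hs Ht]]; [| exact Hc |].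
  { now apply (Cmod_mul_pow_lt_1 q q k). }
  exists s; split.
  - apply is_CSeries_ext with (2 := Hs); intros n.
    rewrite <- !Cpow_mult_r, Nat.mul_comm; reflexivity.
  - apply is_CSeries_ext with (2 := is_CSeries_scal (qpoch_inf q q) _ _ Ht); intros m.
    rewrite (qpoch_inf_split q q (k + m) Hq), Cpow_add_r.
    simpl; rewrite !Cmult_assoc; field; split.
    + now apply qpoch_q_neq_0.
    + apply qpoch_inf_neq_0_disk; [exact Hq |].
      rewrite <- !Cmult_assoc, <- Cpow_add_r; now apply Cmod_mul_pow_lt_1.
Qed.

(** The signs cancel, and twice [n(n-1)/2] plus the [n] from [(b q)^n] is [n^2]. *)
Lemma qpoch_div_pow_square (b q : C) (n : nat) :
  qpoch_div_pow (b * q) 0 q n * qpoch_div_pow 1 0 q n = b ^ n * q ^ (n ^ 2).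
Proof.
  induction n as [| n IH].
  - rewrite !qpoch_div_pow_0; simpl; ring.
  - replace (S n ^ 2)%nat with (n ^ 2 + (n + S n))%nat by (simpl; lia).
    rewrite !qpoch_div_pow_S, !Cpow_add_r, !Cpow_S.
    transitivity (qpoch_div_pow (b * q) 0 q n * qpoch_div_pow 1 0 q n *
                  (b * q * (q ^ n * q ^ n))); [ring |].
    rewrite IH; ring.
Qed.

Lemma INR_le_pow2 (n : nat) : (INR n <= 2 ^ n)%R.
Proof.
  induction n as [| n IH]; [simpl; lra |].
  rewrite S_INR; simpl; generalize (pow_R1_Rle 2 n ltac:(lra)); lra.
Qed.

(** Both series sum one double series [a n m]. Its rows give the first one, times
    [qpoch_inf (b * q) q], by Euler's identity. Along [n + m = N] the factor [qpoch_div_pow c 0 q N]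
    is constant, and [weighted_finite_q_binomial] sums the rest. *)
Lemma weighted_series (b q : C) :
  (Cmod q < 1)%R -> (forall n, b * q * q ^ n <> 1) ->
  exists s,
    is_CSeries (fun n => RtoC (INR (S n)) * b ^ S n * q ^ (S n ^ 2)
                         / (qpoch (b * q) q (S n) * qpoch q q (S n))) s /\
    is_CSeries (fun n => - (qpoch_div_pow (b * q) 0 q (S n) / (1 - q ^ S n)))
      (qpoch_inf (b * q) q * s).
Proof.
  intros Hq Hc; set (c := b * q) in *.
  set (y := fun n => RtoC (INR n) * (qpoch_div_pow 1 0 q n / qpoch q q n)).
  set (a := fun n m => y n * (qpoch_div_pow c 0 q (n + m) / qpoch q q m)).
  (* Replacing the parameter 1 by 2 multiplies the n-th term by [2^n], which absorbs the weight
     [n]. *)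
  destruct (qpoch_div_pow_div_bounded 2 0 q (1 / 2) Hq) as [M HM];
    [rewrite Cmod_0; lra | lra |].
  destruct (qpoch_div_pow_div_bounded c 0 q (1 / 2) Hq) as [K HK];
    [rewrite Cmod_0; lra | lra |].
  destruct (qpoch_div_pow_bounded c 0 q 1 Hq) as [L HL]; [rewrite Cmod_0; lra | lra |].
  assert (Hy : forall n, (Cmod (y n) <= M * (1 / 2) ^ n)%R).
  { intros n; eapply Rle_trans; [| apply HM].
    replace (qpoch_div_pow 2 0 q n) with (2 ^ n * qpoch_div_pow 1 0 q n).
    2:{ rewrite <- qpoch_div_pow_scale, Cmult_1_r, Cmult_0_r; reflexivity. }
    unfold y, Cdiv; rewrite !Cmod_mult, !Rmult_assoc.
    apply Rmult_le_compat_r; [apply Rmult_le_pos; apply Cmod_ge_0 |].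
    rewrite Cmod_pow, !Cmod_R, !Rabs_pos_eq by (try apply pos_INR; lra).
    apply INR_le_pow2. }
  destruct (double_series a (M * (L * K)) (1 / 2)) as [l [Hd [Hrow _]]]; [lra | |].
  { intros n m; unfold a; rewrite qpoch_div_pow_shift.
    replace (qpoch_div_pow c 0 q n * ((q ^ n) ^ m * qpoch_div_pow c 0 q m) / qpoch q q m)
      with (qpoch_div_pow c 0 q n * ((q ^ n) ^ m * (qpoch_div_pow c 0 q m / qpoch q q m)))
      by (unfold Cdiv; ring).
    rewrite !Cmod_mult, Cmod_pow, pow_add.
    specialize (HL n); rewrite pow1, Rmult_1_r in HL.
    assert (Hqn := Cmod_pow_bounds q n Hq).
    replace (M * (L * K) * ((1 / 2) ^ n * (1 / 2) ^ m))%R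
      with (M * (1 / 2) ^ n * (L * (1 * (K * (1 / 2) ^ m))))%R by ring.
    assert (H0 : (0 <= Cmod (q ^ n) ^ m)%R) by (apply pow_le; lra).
    repeat apply Rmult_le_compat; try apply Rmult_le_pos; try apply Rmult_le_pos;
      try apply Cmod_ge_0; auto.
    now apply pow_le_1. }
  assert (Hinf := qpoch_inf_neq_0 c q Hq Hc).
  set (B := fun n => RtoC (INR n) * b ^ n * q ^ (n ^ 2) / (qpoch c q n * qpoch q q n)).
  assert (HB : is_CSeries (fun n => qpoch_inf c q * B n) l).
  { apply Hrow; intros n.
    replace (qpoch_inf c q * B n)
      with (y n * qpoch_div_pow c 0 q n * qpoch_inf (c * q ^ n) q).
    2:{ unfold B, y; rewrite (qpoch_inf_split c q n Hq).
        transitivity (RtoC (INR n) * (qpoch_div_pow c 0 q n * qpoch_div_pow 1 0 q n)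
                      * qpoch_inf (c * q ^ n) q / qpoch q q n).
        { unfold Cdiv; ring. }
        unfold c at 1; rewrite qpoch_div_pow_square; field; split.
        - now apply qpoch_q_neq_0.
        - now apply qpoch_neq_0. }
    apply is_CSeries_ext with (2 := is_CSeries_scal _ _ _ (euler_shift c q n Hq)).
    intros m; unfold a; rewrite qpoch_div_pow_shift; unfold Cdiv; ring. }
  (* The weight kills index 0, here and on the antidiagonal 0 below, so both series may start at
     [S n]. *)
  assert (HB0 : B O = 0) by (unfold B; simpl; unfold Cdiv; ring).
  apply (is_CSeries_scal (/ qpoch_inf c q)), is_CSeries_incr in HB.
  exists (/ qpoch_inf c q * l); split.
  - replace (/ qpoch_inf c q * l)
      with (/ qpoch_inf c q * l - / qpoch_inf c q * (qpoch_inf c q * B O))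
      by (rewrite HB0; ring).
    apply is_CSeries_ext with (2 := HB); intros n; fold (B (S n)); field; exact Hinf.
  - apply is_CSeries_incr in Hd.
    replace (antidiag a 0) with (RtoC 0) in Hd
      by (unfold antidiag, a, y; rewrite Csum_O; simpl; ring).
    replace (qpoch_inf c q * (/ qpoch_inf c q * l)) with (l - 0) by (field; exact Hinf).
    apply is_CSeries_ext with (2 := Hd); intros n.
    transitivity (qpoch_div_pow c 0 q (S n) * (- (1) / (1 - q ^ S n))).
    2:{ unfold Cdiv; ring. }
    rewrite <- weighted_finite_q_binomial, <- antidiag_scal by exact Hq.
    apply antidiag_ext; intros i j Hij; unfold a, y; rewrite Hij; unfold Cdiv; ring.
Qed.

(** Here [s] is the sum over [n >= 0] and [k >= 1] of [a^k q^(nk) / ((c)_n (q)_n (q)_k)]. Summing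
    over [k] first gives the first series, over [n] first the second. *)
Lemma difference_series (a c q : C) :
  (Cmod q < 1)%R -> (Cmod a < 1)%R -> (forall n, c * q ^ n <> 1) ->
  exists s,
    is_CSeries (fun n => 1 / (qpoch c q n * qpoch q q n) * (qpoch a q n - qpoch_inf a q))
      (qpoch_inf a q * s) /\
    is_CSeries (fun n => (qpoch_div_pow c a q (S n) - qpoch_div_pow c 0 q (S n))
                         / (1 - q ^ S n))
      (qpoch_inf q q * qpoch_inf c q * s).
Proof.
  intros Hq Ha Hc.
  (* [Cmod a] controls the decay in [k], [Cmod q] the decay in [n], and 1/2 keeps [r] positive when
     [a = q = 0]. *)
  set (r := Rmax (1 / 2) (Rmax (Cmod a) (Cmod q))).
  assert (Hr : (Cmod a <= r /\ Cmod q <= r /\ 0 < r < 1)%R).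
  { assert (H1 := Rmax_l (1 / 2) (Rmax (Cmod a) (Cmod q))).
    assert (H2 := Rmax_r (1 / 2) (Rmax (Cmod a) (Cmod q))).
    assert (H3 := Rmax_l (Cmod a) (Cmod q)).
    assert (H4 := Rmax_r (Cmod a) (Cmod q)).
    assert (H5 : (r < 1)%R) by (repeat apply Rmax_lub_lt; lra).
    fold r in H1, H2; lra. }
  set (x := fun k => a ^ S k / qpoch q q (S k)).
  destruct (qpoch_div_pow_div_bounded 0 a q r Hq) as [M HM]; [lra | lra |].
  destruct (qpoch_div_pow_div_bounded c 0 q r Hq) as [K HK]; [rewrite Cmod_0; lra | lra |].
  destruct (qpoch_inv_bounded q q Hq) as [I1 HI1].
  { intros n; now apply Cpow_S_neq_1. }
  destruct (qpoch_inv_bounded c q Hq Hc) as [I2 HI2].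
  destruct (qpoch_bounded q q Hq) as [L HL].
  assert (HM0 : (0 <= M)%R).
  { generalize (HM O) (Cmod_ge_0 (qpoch_div_pow 0 a q 0 / qpoch q q 0)); simpl; lra. }
  assert (Hx : forall k, (Cmod (x k) <= M * r ^ k)%R).
  { intros k; specialize (HM (S k)); rewrite qpoch_div_pow_0_l in HM.
    eapply Rle_trans; [exact HM |]; apply Rmult_le_compat_l; [exact HM0 |].
    assert (H := pow_le r k ltac:(lra)); simpl; nra. }
  set (X := fun n => / qpoch c q n * / qpoch q q n).
  assert (HX : forall n, (Cmod (X n) <= I2 * I1)%R).
  { intros n; unfold X; rewrite Cmod_mult.
    apply Rmult_le_compat; auto; apply Cmod_ge_0. }
  assert (Hcn : forall n, qpoch c q n <> 0) by (intros n; now apply qpoch_neq_0).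
  assert (Hqn : forall n, qpoch q q n <> 0) by (intros n; now apply qpoch_q_neq_0).
  assert (Han : forall n, (Cmod (a * q ^ n) < 1)%R)
    by (intros n; now apply Cmod_mul_pow_lt_1).
  set (F := fun k => CSeries (fun n => (q ^ n) ^ S k / (qpoch c q n * qpoch q q n))).
  assert (HF : forall k,
    is_CSeries (fun n => (q ^ n) ^ S k / (qpoch c q n * qpoch q q n)) (F k) /\
    is_CSeries (fun m => qpoch_div_pow c 0 q m / qpoch q q m * qpoch q q (k + m))
      (qpoch_inf q q * (qpoch_inf c q * F k))).
  { intros k; destruct (heine_pow c q k Hq Hc) as [s [Hs Ht]].
    unfold F; rewrite (CSeries_unique _ _ Hs); auto. }
  destruct (double_series (fun n k => X n * (x k * (q ^ n) ^ S k)) (I2 * I1 * M) r)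
    as [s [_ [Hrow Hcol]]]; [lra | |].
  { intros n k; rewrite !Cmod_mult, Cmod_pow, pow_add.
    replace (I2 * I1 * M * (r ^ n * r ^ k))%R with (I2 * I1 * (M * r ^ k * r ^ n))%R by ring.
    assert (H0 := Cmod_pow_bounds q n Hq).
    assert (H1 : (0 <= Cmod (q ^ n) ^ S k)%R) by (apply pow_le; lra).
    apply Rmult_le_compat; [apply Cmod_ge_0 | apply Rmult_le_pos; auto using Cmod_ge_0 | auto |].
    apply Rmult_le_compat; [apply Cmod_ge_0 | exact H1 | auto |].
    (* One of the [k + 1] factors [q ^ n] suffices for the decay in [n]. *)
    apply Rle_trans with (Cmod (q ^ n)).
    - assert (H2 := pow_le_1 _ k H0); assert (H3 := pow_le _ k (proj1 H0)); simpl; nra.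
    - rewrite Cmod_pow; apply pow_incr; split; [apply Cmod_ge_0 | lra]. }
  exists s; split.
  { apply is_CSeries_ext
      with (fun n => qpoch_inf a q * (X n * (/ qpoch_inf (a * q ^ n) q - 1))).
    - intros n; unfold X; rewrite (qpoch_inf_split a q n Hq).
      field; repeat split; auto; now apply qpoch_inf_neq_0_disk.
    - apply is_CSeries_scal, Hrow; intros n; apply is_CSeries_scal.
      (* Subtracting [qpoch_inf a q] in the difference removes exactly the leading 1 of Euler's
         series. *)
      assert (H := is_CSeries_incr _ _ (euler_inv (a * q ^ n) q Hq (Han n))); cbv beta in H.
      replace ((a * q ^ n) ^ 0 / qpoch q q 0) with (RtoC 1) in H
        by (simpl; field; apply C1_nz).
      apply is_CSeries_ext with (2 := H); intros k; unfold x.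
      rewrite Cpow_mult_l; unfold Cdiv; ring. }
  assert (Hs : is_CSeries (fun k => x k * F k) s).
  { apply Hcol; intros k.
    apply is_CSeries_ext with (2 := is_CSeries_scal (x k) _ _ (proj1 (HF k))).
    intros n; unfold X; field; auto. }
  set (y := fun m => qpoch_div_pow c 0 q m / qpoch q q m) in *.
  (* Each inner sum [F k] is itself expanded by Heine; in this array [qpoch q q (k + m)] is constant
     along antidiagonals. *)
  destruct (double_series (fun k m => x k * (y m * qpoch q q (k + m))) (M * (K * L)) r)
    as [t [Hd [Hrow' _]]]; [lra | |].
  { intros k m; rewrite !Cmod_mult, pow_add.
    replace (M * (K * L) * (r ^ k * r ^ m))%R with (M * r ^ k * (K * r ^ m * L))%R by ring.
    repeat apply Rmult_le_compat; try apply Rmult_le_pos; try apply Cmod_ge_0; auto.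
    apply HK. }
  assert (E : qpoch_inf q q * qpoch_inf c q * s = t).
  { apply (is_CSeries_unique (fun k => x k * (qpoch_inf q q * (qpoch_inf c q * F k)))).
    - apply is_CSeries_ext with (2 := is_CSeries_scal (qpoch_inf q q * qpoch_inf c q) _ _ Hs).
      intros k; ring.
    - apply Hrow'; intros k; apply is_CSeries_scal, HF. }
  rewrite E; apply is_CSeries_ext with (2 := Hd); intros n.
  assert (Hn : 1 - q ^ S n <> 0) by (apply Cminus_neq_0; now apply Cpow_S_neq_1).
  (* As [x] starts at exponent 1, antidiagonal [n] belongs to degree [S n]; the missing end term
     [i = 0] is the subtracted [qpoch_div_pow c 0 q (S n)]. *)
  assert (Hfin := finite_q_binomial a c q (S n) Hq).
  rewrite antidiag_S_l in Hfin.
  transitivity (qpoch q q n * antidiag (fun i j => x i * y j) n).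
  { rewrite <- antidiag_scal; apply antidiag_ext; intros i j Hij; rewrite Hij; ring. }
  replace (antidiag (fun i j => x i * y j) n)
    with ((qpoch_div_pow c a q (S n) - qpoch_div_pow c 0 q (S n)) / qpoch q q (S n)).
  - assert (Hqn1 := Hqn n); simpl in Hn |- *; field; auto.
  - transitivity (qpoch_div_pow c a q (S n) / qpoch q q (S n)
                  - qpoch_div_pow c 0 q (S n) / qpoch q q (S n)).
    { unfold Cdiv; ring. }
    rewrite Hfin; unfold x, y; simpl; field.
    assert (H := Hqn (S n)); simpl in H; repeat split; auto using C1_nz.
Qed.

Theorem theorem1p10 (alpha beta q : C)
  (Halpha : (Cmod alpha < 1)%R) (Hq : (Cmod q < 1)%R)
  (Hbeta : forall n : nat, (1 <= n)%nat -> beta * q ^ n <> 1) :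
  let A (n : nat) : C :=
    1 / (qpoch (beta * q) q n * qpoch q q n)
      * (qpoch alpha q n - qpoch_inf alpha q) in
  let B (n : nat) : C :=
    RtoC (INR n) * beta ^ n * q ^ (n ^ 2)
      / (qpoch (beta * q) q n * qpoch q q n) in
  let D (n : nat) : C :=
    qpoch_div_pow (beta * q) alpha q n / (1 - q ^ n) in
  ex_CSeries A /\
  ex_CSeries (fun n => B (S n)) /\
  ex_CSeries (fun n => D (S n)) /\
  CSeries A =
    qpoch_inf alpha q / qpoch_inf q q *
      (CSeries (fun n => B (S n)) +
       1 / qpoch_inf (beta * q) q * CSeries (fun n => D (S n))).
Proof.
  intros A B D.
  assert (Hc : forall n, beta * q * q ^ n <> 1).
  { intros n; rewrite <- Cmult_assoc; apply (Hbeta (S n)); lia. }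
  destruct (weighted_series beta q Hq Hc) as [sB [HB HB']].
  destruct (difference_series alpha (beta * q) q Hq Halpha Hc) as [s [HA HD]].
  (* Adding back the [alpha = 0] part, known from [weighted_series] up to sign, recovers [D]; the
     resulting [sB] then cancels the [B] series in the final identity. *)
  assert (HD' : is_CSeries (fun n => D (S n))
    (qpoch_inf q q * qpoch_inf (beta * q) q * s
     + - (1) * (qpoch_inf (beta * q) q * sB))).
  { apply is_CSeries_ext
      with (2 := is_CSeries_plus _ _ _ _ HD (is_CSeries_scal (- (1)) _ _ HB')).
    intros n; unfold D, Cdiv; ring. }
  split; [eexists; exact HA |].
  split; [eexists; exact HB |].
  split; [eexists; exact HD' |].
  rewrite (CSeries_unique A _ HA), (CSeries_unique (fun n => B (S n)) _ HB),
    (CSeries_unique (fun n => D (S n)) _ HD').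
  field; split.
  - now apply qpoch_inf_neq_0.
  - now apply qpoch_inf_neq_0_disk.
Qed.
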